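(* Let $A\in\mathbb{R}^{n\times n}$ be symmetric positive semidefinite with $A\neq0$, let $B\in\mathbb{R}^{n\times n}$ be symmetric positive definite, let $f(x)=x^TBx-(x^TAx)^{1/2}$, and let $P\in\mathbb{R}^{n\times n}$ be an invertible matrix such that $\tilde B:=P^{-T}BP^{-1}=I$. Put $\tilde A=P^{-T}AP^{-1}$. Consider the iteration, started at a random $x_0\in\mathbb{R}^n$, $$y_k=Px_k,\qquad y_{k+1}=y_k-\alpha\left(2\tilde By_k-\frac{\tilde Ay_k}{(y_k^T\tilde Ay_k)^{1/2}}\right),\qquad x_{k+1}=P^{-1}y_{k+1},$$ with a fixed stepsize $\alpha\equiv\alpha_0$, where $\alpha_0$ is sampled uniformly from $(0,1)$. Then with probability one (precisely: for Lebesgue-almost every pair $(x_0,\alpha_0)\in\mathbb{R}^n\times(0,1)$) the generated sequence $\{x_k\}$ converges to a global minimizer of $f$ over $\mathbb{R}^n$.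
   Context: The iteration is defined as long as $Ax_k\neq0$ (equivalently $y_k^T\tilde Ay_k>0$); the assertion that the generated sequence converges includes that the iteration is well defined for all $k$. $P^{-T}$ denotes $(P^{-1})^T$. *)

(* Defs.v *)
From HB Require Import structures.
From mathcomp Require Import all_boot all_order all_algebra.
From mathcomp Require Import all_classical all_reals all_analysis.

Set Implicit Arguments.
Unset Strict Implicit.
Unset Printing Implicit Defensive.

Import Order.TTheory GRing.Theory Num.Theory.
Import numFieldTopology.Exports numFieldNormedType.Exports.

Local Open Scope classical_set_scope.
Local Open Scope ring_scope.

(* Lebesgue measure on R^n, carried by n.-tuple R with the product (Borel)
   sigma-algebra and built by iterating the binary product with the
   one-dimensional Lebesgue measure; see lebesgue_tuple_box for its value on
   boxes. *)
Section lebesgue_tuple.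
Context {R : realType}.
Local Notation Rm := (measurableTypeR R).

Section cons_measure.
Context {n : nat} (mu : {sigma_finite_measure set (n.-tuple Rm) -> \bar R}).

Definition tcons (p : Rm * n.-tuple Rm) : n.+1.-tuple Rm := [tuple of p.1 :: p.2].

Lemma measurable_tcons : measurable_fun setT tcons.
Proof. exact: measurable_cons. Qed.

Lemma behead_tcons p : [tuple of behead (tcons p)] = p.2.
Proof. exact: val_inj. Qed.

Definition cons_measure : set (n.+1.-tuple Rm) -> \bar R :=
  pushforward (@lebesgue_measure R \x mu)%E tcons.

Let m : {measure set (n.+1.-tuple Rm) -> \bar R} :=
  measure_function_pushforward__canonical__measure_function_Measure
    (@lebesgue_measure R \x mu)%E measurable_tcons.

HB.instance Definition _ := isMeasure.Build _ _ _ cons_measure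
  (measure0 m) (measure_ge0 m) (@measure_semi_sigma_additive _ _ _ m).

Lemma measurable_cons_box (A : set Rm) (B : set (n.-tuple Rm)) :
  measurable A -> measurable B ->
  measurable [set t : n.+1.-tuple Rm | A (thead t) /\ B [tuple of behead t]].
Proof.
move=> mA mB.
have -> : [set t : n.+1.-tuple Rm | A (thead t) /\ B [tuple of behead t]] =
    (fun t : n.+1.-tuple Rm => tnth t ord0) @^-1` A `&`
    (fun t : n.+1.-tuple Rm => [tuple of behead t]) @^-1` B by [].
apply: measurableI; rewrite -[X in measurable X]setTI.
- exact: (measurable_tnth ord0).
- exact: measurable_behead.
Qed.

Lemma cons_measure_box (A : set Rm) (B : set (n.-tuple Rm)) :
  measurable A -> measurable B ->
  cons_measure [set t | A (thead t) /\ B [tuple of behead t]] =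
  (lebesgue_measure A * mu B)%E.
Proof.
move=> mA mB; rewrite -product_measure1E// /cons_measure /pushforward.
congr product_measure1; apply/seteqP; split=> p /=;
  by rewrite behead_tcons.
Qed.

Let cons_sigma_finite : sigma_finite setT cons_measure.
Proof.
have /sigma_finiteP[F [TF ndF Foo]] := sigma_finiteT (@lebesgue_measure R).
have /sigma_finiteP[G [TG ndG Goo]] := sigma_finiteT mu.
exists (fun k => [set t | F k (thead t) /\ G k [tuple of behead t]]).
  apply/esym/seteqP; split=> // t _.
  have : setT (thead t) by []; rewrite TF => -[i _ Fi].
  have : setT [tuple of behead t] by []; rewrite TG => -[j _ Gj].
  exists (maxn i j) => //; split.
  - by move: Fi; exact/subsetPset/ndF/leq_maxl.
  - by move: Gj; exact/subsetPset/ndG/leq_maxr.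
move=> k; have [mF Fk] := Foo k; have [mG Gk] := Goo k.
split; first exact: measurable_cons_box.
by rewrite cons_measure_box// lte_mul_pinfty// ge0_fin_numE.
Qed.

HB.instance Definition _ := Measure_isSigmaFinite.Build _ _ _ cons_measure
  cons_sigma_finite.

End cons_measure.

Fixpoint lebesgue_tuple (n : nat) :
    {sigma_finite_measure set (n.-tuple Rm) -> \bar R} :=
  match n with
  | 0 => \d_ ([tuple] : 0.-tuple Rm)
  | n'.+1 => cons_measure (lebesgue_tuple n')
  end.

Lemma lebesgue_tuple_box (n : nat) (A : 'I_n -> set Rm) :
  (forall i, measurable (A i)) ->
  lebesgue_tuple n [set t | forall i, A i (tnth t i)] =
  (\prod_(i < n) lebesgue_measure (A i))%E.
Proof.
elim: n A => [|n ih] A mA.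
  by rewrite big_ord0 /= diracE mem_set// => -[].
have beheadE (t : n.+1.-tuple Rm) i :
    tnth t (lift ord0 i) = tnth [tuple of behead t] i.
  by rewrite [in LHS](tuple_eta t) tnthS.
have mbox : measurable
    [set t : n.-tuple Rm | forall i, A (lift ord0 i) (tnth t i)].
  rewrite (_ : [set t | _] = \big[setI/setT]_(i < n)
      ((fun t : n.-tuple Rm => tnth t i) @^-1` A (lift ord0 i))); last first.
    apply/seteqP; split=> t /=.
      by move=> At; elim/big_ind: _ => //= *; split.
    by move=> At i; move: At; rewrite (bigD1 i)//= => -[].
  apply: bigsetI_measurable => i _; rewrite -[X in measurable X]setTI.
  exact: measurable_tnth.
rewrite big_ord_recl /= -ih// -cons_measure_box//.
congr cons_measure; apply/seteqP; split=> t /=.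
- by move=> At; split=> [|i]; [exact: At | rewrite -beheadE; exact: At].
- move=> [A0 At] i; case: (unliftP ord0 i) => [j ->|->//].
  by have := At j; rewrite -beheadE.
Qed.

End lebesgue_tuple.

Definition col_of_tuple (R : realType) (n : nat)
    (t : n.-tuple (measurableTypeR R)) : 'cV[R]_n :=
  \col_i (tnth t i : R).

Section iteration.
Context {R : realType} {n : nat}.
Implicit Types (A B P M : 'M[R]_n) (x y : 'cV[R]_n) (alpha : R).

Definition qform M x : R := (x^T *m M *m x) 0 0.

Definition sym_psd M := M^T = M /\ forall x, 0 <= qform M x.

Definition sym_pd M := M^T = M /\ forall x, x != 0 -> 0 < qform M x.

Definition objective A B x : R := qform B x - Num.sqrt (qform A x).

(* P^{-T} M P^{-1} *)
Definition transform P M : 'M[R]_n := (invmx P)^T *m M *m invmx P.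

(* At and Bt stand for the transformed matrices. When qform At y = 0 the
   inverse is 0 by convention, so well-definedness of the iteration has to be
   asserted separately: see iteration_defined. *)
Definition step At Bt alpha y : 'cV[R]_n :=
  y - alpha *: (2 *: (Bt *m y) - (Num.sqrt (qform At y))^-1 *: (At *m y)).

Fixpoint iterates A B P alpha x0 (k : nat) : 'cV[R]_n :=
  match k with
  | 0 => x0
  | k'.+1 =>
      invmx P *m step (transform P A) (transform P B) alpha
                      (P *m iterates A B P alpha x0 k')
  end.

Definition iteration_defined A B P alpha x0 : Prop :=
  forall k, A *m iterates A B P alpha x0 k != 0.

Definition global_minimizer (f : 'cV[R]_n -> R) x : Prop :=
  forall z, f x <= f z.

Definition converges_to_global_minimizer A B P alpha x0 : Prop :=
  iteration_defined A B P alpha x0 /\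
  exists2 x, iterates A B P alpha x0 @ \oo --> x &
             global_minimizer (objective A B) x.

End iteration.

(* Main.v *)
(* In the coordinates y = P x the iteration is gradient descent for
   |y|^2 - sqrt (y^T M y) with M = P^{-T} A P^{-1}.  Let L be the largest
   eigenvalue of M, v an eigenvector for L, and s_k = sqrt (y_k^T M y_k).

   Convergence as long as v.y_k never vanishes.  The objective decreases by at
   least a (1 - a) |grad|^2 per step, so the gradients tend to 0 and, because
   y.grad = 2 |y|^2 - s, the s_k converge.  The component v.y_k is multiplied
   by 1 - 2 a + a L / s_k at each step; boundedness of the iterates then forces
   s_k -> L / 2, i.e. the minimal objective value.  Finally y_k is asymptotically
   in the top eigenspace, where all components carry the same scalar factor.

   Almost surely v.y_k never vanishes.  Fix x_0 with v.y_0 <> 0.  Clearing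
   denominators, v.y_k is an algebraic function of the stepsize a, built with k
   nested square roots.  Eliminating them by taking norms over all sign choices
   yields a polynomial in a, which is nonzero because at a = 0 the iteration is
   stationary on every branch.  Hence only countably many a are exceptional, and
   Fubini concludes. *)
Require Import Defs.
From HB Require Import structures.
From mathcomp Require Import all_boot all_order all_algebra.
From mathcomp Require Import all_classical all_reals all_analysis.
From mathcomp Require Import measurable_realfun finmap ring lra.

Set Implicit Arguments.
Unset Strict Implicit.
Unset Printing Implicit Defensive.

Import Order.TTheory GRing.Theory Num.Theory.
Import numFieldTopology.Exports numFieldNormedType.Exports.

Local Open Scope classical_set_scope.
Local Open Scope ring_scope.

(** * Dot product, positive semidefinite forms and their top eigenvector *)

Section symmetric_forms.
Context {R : realType} {n : nat}.
Implicit Types (M N : 'M[R]_n) (x y z : 'cV[R]_n) (a : R).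

Definition dot x y : R := (x^T *m y) 0 0.

Lemma dotE x y : dot x y = \sum_i x i 0 * y i 0.
Proof. by rewrite /dot mxE; apply: eq_bigr => i _; rewrite mxE. Qed.

Lemma dotC x y : dot x y = dot y x.
Proof. by rewrite !dotE; apply: eq_bigr => i _; rewrite mulrC. Qed.

Lemma dot0r x : dot x 0 = 0.
Proof. by rewrite /dot mulmx0 mxE. Qed.

Lemma dotDr x y z : dot x (y + z) = dot x y + dot x z.
Proof. by rewrite /dot mulmxDr mxE. Qed.

Lemma dotZr a x y : dot x (a *: y) = a * dot x y.
Proof. by rewrite /dot -scalemxAr mxE. Qed.

Lemma dotNr x y : dot x (- y) = - dot x y.
Proof. by rewrite /dot mulmxN mxE. Qed.

Lemma dotDl x y z : dot (y + z) x = dot y x + dot z x.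
Proof. by rewrite dotC dotDr !(dotC x). Qed.

Lemma dotZl a x y : dot (a *: y) x = a * dot y x.
Proof. by rewrite dotC dotZr !(dotC x). Qed.

Lemma dotNl x y : dot (- y) x = - dot y x.
Proof. by rewrite dotC dotNr !(dotC x). Qed.

Definition dot_linear := (dotDr, dotDl, dotZr, dotZl, dotNr, dotNl).

Lemma dot_add_le x y : dot (x + y) (x + y) <= 2 * (dot x x + dot y y).
Proof.
have : 0 <= dot (x - y) (x - y).
  by rewrite dotE; apply: sumr_ge0 => i _; rewrite -expr2 sqr_ge0.
by rewrite !dot_linear (dotC y x); lra.
Qed.

Lemma dot_mulmxl M x y : dot (M *m x) y = dot x (M^T *m y).
Proof. by rewrite /dot trmx_mul mulmxA. Qed.

Lemma qformE M x : qform M x = dot x (M *m x).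
Proof. by rewrite /qform /dot mulmxA. Qed.

Lemma dot_ge0 x : 0 <= dot x x.
Proof. by rewrite dotE; apply: sumr_ge0 => i _; rewrite -expr2 sqr_ge0. Qed.

Lemma coord_sqr_le x i : x i 0 ^+ 2 <= dot x x.
Proof.
rewrite dotE (bigD1 i)//= -expr2 lerDl.
by apply: sumr_ge0 => j _; rewrite -expr2 sqr_ge0.
Qed.

Lemma dot_eq0 x : (dot x x == 0) = (x == 0).
Proof.
apply/eqP/eqP => [x0|->]; last by rewrite dotE big1// => i _; rewrite mxE mul0r.
apply/colP => i; rewrite mxE; apply/eqP; rewrite -sqrf_eq0 eq_le sqr_ge0 andbT.
by rewrite -x0 coord_sqr_le.
Qed.

Lemma dot_gt0 x : (0 < dot x x) = (x != 0).
Proof. by rewrite lt_neqAle dot_ge0 andbT eq_sym dot_eq0. Qed.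

(** The form is nonnegative on every u x + v y. The choices (u, v) = (r, -b) and (-b, p) settle the
    cases r > 0 and p > 0; if both vanish, (1, -b) forces b = 0. *)
Lemma psd_cauchy_schwarz M x y : sym_psd M ->
  dot x (M *m y) ^+ 2 <= qform M x * qform M y.
Proof.
case=> Ms Mp; set b := dot _ _; set p := qform M x; set r := qform M y.
have yx : dot y (M *m x) = b by rewrite /b [RHS]dotC dot_mulmxl Ms.
have E u v : qform M (u *: x + v *: y) = u ^+ 2 * p + u * v * b *+ 2 + v ^+ 2 * r.
  rewrite qformE mulmxDr -!scalemxAr !dot_linear yx -/b -!qformE -/p -/r; ring.
have p0 : 0 <= p by exact: Mp.
have r0 : 0 <= r by exact: Mp.
have H u v : 0 <= u ^+ 2 * p + u * v * b *+ 2 + v ^+ 2 * r by rewrite -E Mp.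
have [r_gt0|] := ltP 0 r.
  have := H r (- b).
  have -> : r ^+ 2 * p + r * - b * b *+ 2 + (- b) ^+ 2 * r = r * (p * r - b ^+ 2).
    by ring.
  by rewrite pmulr_rge0// subr_ge0.
move=> r_le0; have {}r0 : r = 0 by apply/eqP; rewrite eq_le r_le0.
have [p_gt0|] := ltP 0 p.
  have := H (- b) p.
  have -> : (- b) ^+ 2 * p + - b * p * b *+ 2 + p ^+ 2 * r = p * (p * r - b ^+ 2).
    by ring.
  by rewrite pmulr_rge0// subr_ge0.
move=> p_le0; have {}p0 : p = 0 by apply/eqP; rewrite eq_le p_le0.
have := H 1 (- b); rewrite p0 r0; nra.
Qed.

Lemma scalar_sym_psd : sym_psd (1%:M : 'M[R]_n).
Proof. by split=> [|x]; rewrite ?trmx1// qformE mul1mx dot_ge0. Qed.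

Lemma cauchy_schwarz x y : dot x y ^+ 2 <= dot x x * dot y y.
Proof.
by have := psd_cauchy_schwarz x y scalar_sym_psd; rewrite !qformE !mul1mx.
Qed.

Lemma qform_bound M : exists2 C, 0 <= C & forall x, qform M x <= C * dot x x.
Proof.
exists (\sum_i \sum_j `|M i j|).
  by apply: sumr_ge0 => i _; apply: sumr_ge0.
move=> x; rewrite qformE dotE mulr_suml; apply: ler_sum => i _.
rewrite mxE mulr_sumr mulr_suml; apply: ler_sum => j _.
have := coord_sqr_le x i; have := coord_sqr_le x j.
set u := x i 0; set v := x j 0; set d := dot x x => vd ud.
have uv : `|u * v| <= d.
  rewrite ler_norml; apply/andP; split.
    have := sqr_ge0 (u + v); rewrite sqrrD; nra.
  have := sqr_ge0 (u - v); rewrite sqrrB; nra.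
apply: le_trans (ler_norm _) _.
by rewrite mulrCA normrM ler_wpM2l.
Qed.

(** Cauchy-Schwarz for [M *m x] against [x] bounds |Mx|^4 by a multiple of the vanishing form. *)
Lemma psd_eq0 M x : sym_psd M -> qform M x = 0 -> M *m x = 0.
Proof.
move=> pM q0; apply/eqP; rewrite -dot_eq0; apply/eqP.
have := psd_cauchy_schwarz (M *m x) x pM; rewrite q0 mulr0 => h.
by apply/eqP; rewrite -sqrf_eq0 eq_le h sqr_ge0.
Qed.

(** Cauchy-Schwarz between x and M^-1 x gives |x|^4 <= (x.Mx)(x.M^-1 x), and the last factor is at
    most C |x|^2. Passing to C + 1 makes the constant positive even when C = 0. *)
Lemma psd_invertible_coercive M : sym_psd M -> M \in unitmx ->
  exists2 c, 0 < c & forall x, c * dot x x <= qform M x.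
Proof.
move=> pM uM; have [C C0 Cb] := qform_bound (invmx M).
exists (C + 1)^-1 => [|x]; first by rewrite invr_gt0; lra.
have := psd_cauchy_schwarz x (invmx M *m x) pM.
rewrite mulKVmx//.
have -> : qform M (invmx M *m x) = qform (invmx M) x.
  by rewrite !qformE mulKVmx// dotC.
move=> h; rewrite mulrC ler_pdivrMr; last by lra.
have [->|x0] := eqVneq x 0.
  by rewrite qformE mulmx0 dot0r mul0r.
have d0 : 0 < dot x x by rewrite dot_gt0.
have := Cb x; have := pM.2 x; nra.
Qed.

(* The supremum L of the Rayleigh quotient is an eigenvalue: L I - M is
   positive semidefinite, and coercive if invertible, which would lower L. *)
Lemma top_eigenvector M : sym_psd M -> M != 0 ->
  exists (L : R) (v : 'cV[R]_n), [/\ 0 < L, v != 0, M *m v = L *: v &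
                  forall x, qform M x <= L * dot x x].
Proof.
move=> pM M0.
have [w w0] : exists w, 0 < qform M w.
  apply/not_existsP => h; case/eqP: M0; apply/matrixP => i j.
  have : M *m delta_mx j 0 = 0 :> 'cV_n.
    apply: psd_eq0 => //; apply/eqP; rewrite eq_le pM.2 andbT leNgt.
    exact/negP/h.
  by rewrite -colE => /colP/(_ i); rewrite !mxE.
have wn : w != 0.
  by apply: contraTneq w0 => ->; rewrite qformE mulmx0 dot0r ltxx.
have [C C0 Cb] := qform_bound M.
pose S := [set r | exists2 x, 0 < dot x x & r = qform M x / dot x x].
have Sw : S (qform M w / dot w w) by exists w; rewrite ?dot_gt0.
have Sub : has_ubound S.
  by exists C => _ [x x0 ->]; rewrite ler_pdivrMr.
have Ssup : has_sup S by split=> //; exists (qform M w / dot w w).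
pose L := sup S.
have L0 : 0 < L.
  apply: lt_le_trans (ub_le_sup Sub Sw).
  by rewrite divr_gt0// dot_gt0.
have ML x : qform M x <= L * dot x x.
  have [->|x0] := eqVneq x 0.
    by rewrite qformE mulmx0 dot0r mulr0.
  rewrite -ler_pdivrMr ?dot_gt0//; apply: ub_le_sup => //.
  by exists x; rewrite ?dot_gt0.
have NE x : qform (L%:M - M) x = L * dot x x - qform M x.
  by rewrite !qformE mulmxBl mul_scalar_mx !dot_linear.
have pN : sym_psd (L%:M - M).
  split=> [|x]; first by rewrite linearB /= tr_scalar_mx pM.1.
  by rewrite NE subr_ge0.
have [uN|] := boolP (L%:M - M \in unitmx).
  have [c c0 Nc] := psd_invertible_coercive pN uN.
  suff : L <= L - c by lra.
  apply: ge_sup; first by exists (qform M w / dot w w).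
  move=> _ [x x0 ->]; rewrite ler_pdivrMr//.
  have := Nc x; rewrite NE; lra.
(* A singular L I - M has a left null vector; by symmetry its transpose is an eigenvector of M. *)
rewrite unitmxE unitfE negbK => /det0P[u u0 uN].
exists L, u^T; split => //; first by rewrite trmx_eq0.
apply/esym/eqP; rewrite -mul_scalar_mx -subr_eq0 -mulmxBl -pN.1 -trmx_mul uN.
by rewrite trmx0.
Qed.

(** By symmetry the row space of M meets its kernel trivially, so M and M^2 have the same rank and
    the same row space. This replaces diagonalization when projecting onto an eigenspace. *)
Lemma sym_submx_square M : M^T = M -> exists D, M = D *m M *m M.
Proof.
move=> Ms; suff /submxP[D MD] : (M <= M *m M)%MS by exists D; rewrite -mulmxA.
have kM : (M :&: kermx M)%MS = 0.
  apply/eqP; rewrite -submx0; apply/rV_subP => u.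
  rewrite sub_capmx => /andP[/submxP[w uE] /sub_kermxP uM].
  (* If u = w M and u M = 0, then u u^T = w (u M)^T = 0. *)
  suff : u^T == 0 by rewrite trmx_eq0 => /eqP ->; exact: sub0mx.
  rewrite -dot_eq0 /dot trmxK {1}uE -mulmxA -{1}Ms -trmx_mul uM.
  by rewrite trmx0 mulmx0 mxE.
rewrite -(mxrank_leqif_sup (submxMl M M)).
by have := mxrank_mul_ker M M; rewrite kM mxrank0 addn0 => ->.
Qed.

End symmetric_forms.

(** * Coordinatewise limits of vector sequences *)

Section entrywise_convergence.
Context {R : realType} {n : nat}.
Implicit Types (M : 'M[R]_n) (y z : nat -> 'cV[R]_n) (l : 'cV[R]_n).

Lemma cvg_finite_sum (I : Type) (r : seq I) (f : I -> nat -> R) (b : I -> R) :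
  (forall i, f i @ \oo --> b i) ->
  \sum_(i <- r) f i k @[k --> \oo] --> \sum_(i <- r) b i.
Proof.
move=> fb; elim: r => [|i r ih].
  by rewrite big_nil; under eq_fun do rewrite big_nil; exact: cvg_cst.
rewrite big_cons; under eq_fun do rewrite big_cons.
exact: (cvgD (fb i) ih).
Qed.

(** Working by coordinates reduces every limit to real sequences; [ecvg_cvg] returns to the matrix
    topology at the very end. *)
Definition ecvg y l := forall i, y k i 0 @[k --> \oo] --> l i 0.

Lemma ecvg_cvg y l : ecvg y l -> y @ \oo --> l.
Proof.
move=> yl; apply/cvg_ballP => e e0.
have : \forall k \near \oo, forall i, ball (l i 0) e (y k i 0).
  by apply: filter_forall => i; exact: (cvg_ball (yl i)).
apply: filterS => k yk; split => // i j.
by rewrite (ord1 j).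
Qed.

Lemma ecvgD y z l l' : ecvg y l -> ecvg z l' ->
  ecvg (fun k => y k + z k) (l + l').
Proof.
move=> yl zl i; rewrite mxE.
by under eq_fun do rewrite mxE; exact: (cvgD (yl i) (zl i)).
Qed.

Lemma ecvgZ (a : nat -> R) (b : R) y l : a @ \oo --> b -> ecvg y l ->
  ecvg (fun k => a k *: y k) (b *: l).
Proof.
move=> ab yl i; rewrite mxE.
by under eq_fun do rewrite mxE; exact: (cvgM ab (yl i)).
Qed.

Lemma ecvg_cst l : ecvg (fun=> l) l.
Proof. by move=> i; exact: cvg_cst. Qed.

Lemma ecvg_mulmx M y l : ecvg y l -> ecvg (fun k => M *m y k) (M *m l).
Proof.
move=> yl i; rewrite mxE; under eq_fun do rewrite mxE.
by apply: cvg_finite_sum => j; apply: cvgM; [exact: cvg_cst|exact: yl].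
Qed.

Lemma cvg_dot y z l l' : ecvg y l -> ecvg z l' ->
  dot (y k) (z k) @[k --> \oo] --> dot l l'.
Proof.
move=> yl zl; rewrite dotE; under eq_fun do rewrite dotE.
by apply: cvg_finite_sum => j; apply: cvgM; [exact: yl|exact: zl].
Qed.

Lemma cvg_qform M y l : ecvg y l -> qform M (y k) @[k --> \oo] --> qform M l.
Proof.
move=> yl; rewrite qformE; under eq_fun do rewrite qformE.
by apply: cvg_dot => //; exact: ecvg_mulmx.
Qed.

Lemma cvg0_sqr_le (a b : nat -> R) C : (forall k, a k ^+ 2 <= C * b k) ->
  b @ \oo --> (0 : R) -> a @ \oo --> (0 : R).
Proof.
move=> ab b0.
have a2 : a k ^+ 2 @[k --> \oo] --> (0 : R).
  apply: (@squeeze_cvgr _ _ _ _ (fun=> 0) (fun k => C * b k)).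
  - by apply: nearW => k; rewrite sqr_ge0 ab.
  - exact: cvg_cst.
  - by rewrite -[0](mulr0 C); apply: cvgM => //; exact: cvg_cst.
apply/norm_cvg0P.
rewrite (_ : (fun k => _) = fun k => Num.sqrt (a k ^+ 2)); last first.
  by apply/funext => k; rewrite sqrtr_sqr.
by rewrite -(sqrtr0 R); apply: continuous_cvg => //; exact: sqrt_continuous.
Qed.

Lemma ecvg0_dot y C (b : nat -> R) : (forall k, dot (y k) (y k) <= C * b k) ->
  b @ \oo --> (0 : R) -> ecvg y 0.
Proof.
move=> yb b0 i; rewrite mxE; apply: cvg0_sqr_le b0 => k.
exact: le_trans (coord_sqr_le _ _) (yb k).
Qed.

End entrywise_convergence.

(** * Descent and convergence in the transformed coordinates *)

Section gradient_iteration.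
Context {R : realType} {n : nat}.
Variables (M : 'M[R]_n) (L alpha : R) (v : 'cV[R]_n).
Hypotheses (pM : sym_psd M) (L0 : 0 < L) (Mv : M *m v = L *: v).
Hypothesis (ML : forall x, qform M x <= L * dot x x).
Implicit Type x : 'cV[R]_n.

Definition snorm x : R := Num.sqrt (qform M x).

Lemma snorm_ge0 x : 0 <= snorm x. Proof. exact: sqrtr_ge0. Qed.

Lemma snorm_sqr x : snorm x ^+ 2 = qform M x.
Proof. by rewrite sqr_sqrtr// pM.2. Qed.

Lemma snorm_gt0 x : (0 < snorm x) = (0 < qform M x).
Proof. exact: sqrtr_gt0. Qed.

Lemma objective_scalarE x : objective M 1%:M x = dot x x - snorm x.
Proof. by rewrite /objective (qformE 1%:M) mul1mx. Qed.

(** With t = [snorm x], L|x|^2 >= t^2, so L times the objective is at least t^2 - L t = (t - L/2)^2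
    - L^2/4. *)
Lemma objective_ge x : - (L / 4) <= objective M 1%:M x.
Proof.
rewrite objective_scalarE; have := ML x; rewrite -snorm_sqr.
have := snorm_ge0 x; set t := snorm x; set d := dot x x => t0 td.
have := sqr_ge0 (t - L / 2) => h.
rewrite -(ler_pM2l L0); nra.
Qed.

(** Sublevel sets are bounded: t <= (|x|^2 + L)/2 by the arithmetic-geometric mean inequality. *)
Lemma dot_le_objective x : dot x x <= 2 * objective M 1%:M x + L.
Proof.
rewrite objective_scalarE; have := ML x; rewrite -snorm_sqr.
have := snorm_ge0 x; have := dot_ge0 x.
set t := snorm x; set d := dot x x => d0 t0 td.
have dL : 0 <= (d + L) / 2 by move: L0; lra.
have : t <= (d + L) / 2.
  rewrite -(@ler_pXn2r _ 2)// ?nnegrE//.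
  by apply: le_trans td _; have := sqr_ge0 (d - L); nra.
lra.
Qed.

Lemma dot_eigenvector x : dot v (M *m x) = L * dot v x.
Proof. by rewrite -{1}pM.1 -dot_mulmxl Mv dotZl. Qed.

(** If the form vanished at x, then Mx = 0 and L (v.x) = v.Mx = 0. This keeps the denominators of
    the iteration positive. *)
Lemma qform_gt0 x : dot v x != 0 -> 0 < qform M x.
Proof.
move=> vx; rewrite lt_neqAle pM.2 andbT; apply: contra_neq vx => /esym q0.
have := dot_eigenvector x; rewrite psd_eq0// dot0r => /esym/eqP.
by rewrite mulf_eq0 gt_eqF//= => /eqP.
Qed.

Hypothesis alpha01 : 0 < alpha < 1.

Let grad x : 'cV[R]_n := 2 *: x - (snorm x)^-1 *: (M *m x).

Lemma stepE x : step M 1%:M alpha x = x - alpha *: grad x.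
Proof. by rewrite /step /grad mul1mx. Qed.

Lemma step_linearE x : step M 1%:M alpha x =
  (1 - 2 * alpha) *: x + (alpha / snorm x) *: (M *m x).
Proof.
rewrite stepE /grad scalerBr opprB !scalerA addrCA addrC scalerBl scale1r.
by rewrite (mulrC 2).
Qed.

(* snorm M is convex, so - snorm M lies below its linearization and only the
   term |x|^2 contributes at second order. *)
Lemma objective_step x : 0 < qform M x ->
  objective M 1%:M (step M 1%:M alpha x) <=
  objective M 1%:M x - alpha * (1 - alpha) * dot (grad x) (grad x).
Proof.
move=> q0; rewrite !objective_scalarE stepE.
set g := grad x; set z := x - _.
(* The bound z.Mx <= s' s is the tangent inequality of the convex function [snorm] at x. *)
have := psd_cauchy_schwarz z x pM; rewrite -!snorm_sqr -exprMn.
have := snorm_ge0 z; rewrite -snorm_gt0 in q0.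
set s := snorm x in q0 *; set s' := snorm z => s'0 h.
have ss'0 : 0 <= s' * s by rewrite mulr_ge0// ltW.
have : dot z (M *m x) <= s' * s.
  apply: le_trans (ler_norm _) _; rewrite -(@ler_pXn2r _ 2)// ?nnegrE//.
  by rewrite real_normK ?num_real.
(* The first-order change of the objective is thus at most -alpha |g|^2, and |x|^2 adds alpha^2
   |g|^2. *)
have E : dot g g = 2 * dot g x - s^-1 * dot g (M *m x).
  by rewrite {2}/g /grad dotDr dotNr !dotZr.
clearbody g.
rewrite /z !dot_linear (dotC x g) -qformE -snorm_sqr -/s.
set t := dot g (M *m x) in E *; set w := dot g x in E *; set gg := dot g g in E *.
move=> {}h.
have {}h : s - alpha * (s^-1 * t) <= s'.
  rewrite -(ler_pM2r q0); apply: le_trans h.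
  by rewrite mulrBl -mulrA -(mulrA s^-1) (mulrC t) mulKf ?gt_eqF// expr2.
by rewrite E; lra.
Qed.

Variable y : nat -> 'cV[R]_n.
Hypothesis yS : forall k, y k.+1 = step M 1%:M alpha (y k).
Hypothesis vy : forall k, dot v (y k) != 0.

Let s k : R := snorm (y k).
Let F k : R := objective M 1%:M (y k).
Let g k := grad (y k).
Let u k : R := dot v (y k).
Let c k : R := 1 - 2 * alpha + alpha * L / s k.

Lemma snorm_iter_gt0 k : 0 < s k.
Proof. by rewrite snorm_gt0 qform_gt0. Qed.

Lemma dot_grad_le k :
  dot (g k) (g k) <= (alpha * (1 - alpha))^-1 * (F k - F k.+1).
Proof.
have a0 : 0 < alpha * (1 - alpha).
  by case/andP: alpha01 => a0 a1; rewrite mulr_gt0// subr_gt0.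
rewrite -(ler_pM2l a0) mulVKf ?gt_eqF// lerBrDl -lerBrDr /F yS.
exact/objective_step/qform_gt0.
Qed.

Lemma objective_iter_nonincreasing : {homo F : i j / (i <= j)%N >-> j <= i}.
Proof.
apply/nonincreasing_seqP => k; have := dot_grad_le k.
have a0 : 0 < (alpha * (1 - alpha))^-1.
  by case/andP: alpha01 => a0 a1; rewrite invr_gt0 mulr_gt0// subr_gt0.
move=> /(le_trans (dot_ge0 _)); rewrite pmulr_rge0// subr_ge0.
exact.
Qed.

Lemma objective_iter_cvg : F @ \oo --> limn F.
Proof.
apply: (nonincreasing_is_cvgn objective_iter_nonincreasing).
by exists (- (L / 4)) => _ [k _ <-]; exact: objective_ge.
Qed.

Let C : R := 2 * F 0%N + L.

Lemma dot_iter_le k : dot (y k) (y k) <= C.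
Proof.
apply: le_trans (dot_le_objective _) _; rewrite lerD2r ler_pM2l//.
exact: objective_iter_nonincreasing.
Qed.

Lemma dot_grad_cvg0 : dot (g k) (g k) @[k --> \oo] --> (0 : R).
Proof.
apply: (@squeeze_cvgr _ _ _ _ (fun=> 0)
  (fun k => (alpha * (1 - alpha))^-1 * (F k - F k.+1))).
- by apply: nearW => k; rewrite dot_ge0 dot_grad_le.
- exact: cvg_cst.
- rewrite -[X in _ --> X](mulr0 (alpha * (1 - alpha))^-1).
  apply: cvgM; first exact: cvg_cst.
  rewrite -[X in _ --> X](subrr (limn F)); apply: cvgB.
    exact: objective_iter_cvg.
  by rewrite cvg_shiftS; exact: objective_iter_cvg.
Qed.

Lemma dot_grad_iter k : dot (y k) (g k) = 2 * dot (y k) (y k) - s k.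
Proof.
rewrite /g /grad dotDr dotNr !dotZr -qformE -snorm_sqr -/(s k) expr2 mulKf//.
by rewrite gt_eqF// snorm_iter_gt0.
Qed.

Lemma dot_grad_iter_cvg0 : dot (y k) (g k) @[k --> \oo] --> (0 : R).
Proof.
apply: (@cvg0_sqr_le _ _ (fun k => dot (g k) (g k)) C) dot_grad_cvg0 => k.
apply: le_trans (cauchy_schwarz _ _) _.
by rewrite ler_wpM2r ?dot_ge0// dot_iter_le.
Qed.

(** The value is forced: y.g = 2 F + s, and y.g tends to 0. *)
Let slim : R := - (2 * limn F).

Lemma snorm_iter_cvg : s @ \oo --> slim.
Proof.
rewrite (_ : s = fun k => dot (y k) (g k) - 2 * F k); last first.
  apply/funext => k; rewrite dot_grad_iter /F objective_scalarE -/(s k); lra.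
rewrite -[slim]add0r; apply: cvgB; first exact: dot_grad_iter_cvg0.
by apply: cvgM; [exact: cvg_cst|exact: objective_iter_cvg].
Qed.

Lemma dot_iter_cvg : dot (y k) (y k) @[k --> \oo] --> slim / 2.
Proof.
rewrite (_ : (fun k => _) = fun k => F k + s k); last first.
  by apply/funext => k; rewrite /F objective_scalarE -/(s k) subrK.
rewrite (_ : slim / 2 = limn F + slim); last by rewrite /slim; lra.
by apply: cvgD; [exact: objective_iter_cvg|exact: snorm_iter_cvg].
Qed.

Lemma slim_ge0 : 0 <= slim.
Proof.
apply: ler_cvg_to (cvg_cst 0) snorm_iter_cvg _.
by apply: nearW => k; exact/ltW/snorm_iter_gt0.
Qed.

(** In the limit s_k^2 <= L |y_k|^2 reads slim^2 <= L slim / 2; divide by slim unless it is 0. *)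
Lemma slim_le : slim <= L / 2.
Proof.
have := slim_ge0; rewrite le_eqVlt => /predU1P[<-|l0].
  by rewrite divr_ge0// ltW.
rewrite -(ler_pM2r l0) [leRHS]mulrAC -mulrA.
have Ld : L * dot (y k) (y k) @[k --> \oo] --> L * (slim / 2).
  by apply: cvgM; [exact: cvg_cst|exact: dot_iter_cvg].
have Ls : s k ^+ 2 @[k --> \oo] --> slim * slim.
  exact: (cvgM snorm_iter_cvg snorm_iter_cvg).
by apply: ler_cvg_to Ls Ld _; apply: nearW => k; rewrite snorm_sqr.
Qed.

Lemma dot_eigenvector_step k : u k.+1 = c k * u k.
Proof.
rewrite /u yS step_linearE dotDr !dotZr dot_eigenvector -/(s k) /c; ring.
Qed.

Lemma dot_eigenvector_iter_le k : u k ^+ 2 <= dot v v * C.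
Proof.
apply: le_trans (cauchy_schwarz _ _) _.
by rewrite ler_wpM2l ?dot_ge0// dot_iter_le.
Qed.

(* A smaller limit would make the factor c eventually exceed some q > 1, and
   the component along v would be unbounded. *)
Lemma slim_eq : slim = L / 2.
Proof.
apply/eqP; rewrite eq_le slim_le leNgt; apply/negP => slt.
have a0 : 0 < alpha by case/andP: alpha01.
(* Eventually s_k lies below this midpoint, so c_k >= q, and q > 1 because L / m > 2. *)
pose m := (slim + L / 2) / 2.
have m_gt : slim < m by rewrite /m; lra.
have m_lt : m < L / 2 by rewrite /m; lra.
have m_gt0 : 0 < m by exact: le_lt_trans slim_ge0 m_gt.
pose q := 1 - 2 * alpha + alpha * L / m.
have q1 : 1 < q.
  rewrite /q -mulrA; have : 2 < L / m by rewrite ltr_pdivlMr//; lra.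
  set r := L / m => r2; have : 0 < alpha * (r - 2) by rewrite mulr_gt0// subr_gt0.
  lra.
have [N _ cN] : \forall k \near \oo, q <= c k.
  near=> k; rewrite /q /c lerD2l -!mulrA !ler_pM2l//.
  rewrite lef_pV2 ?posrE// ?snorm_iter_gt0//; apply/ltW.
  by near: k; exact: (cvgr_lt _ snorm_iter_cvg).
(* A linear lower bound of Bernoulli type already contradicts boundedness; it uses c^2 >= q. *)
have u2 k : u (N + k)%N ^+ 2 >= (1 + k%:R * (q - 1)) * u N ^+ 2.
  elim: k => [|k ih]; first by rewrite addn0 mul0r addr0 mul1r.
  rewrite addnS dot_eigenvector_step exprMn.
  have ck : q <= c (N + k)%N by apply: cN; exact: leq_addr.
  have uN : 0 <= u N ^+ 2 by exact: sqr_ge0.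
  have k0 : 0 <= k%:R :> R by exact: ler0n.
  have q0 : 0 <= q - 1 by lra.
  apply: (@le_trans _ _ (q * ((1 + k%:R * (q - 1)) * u N ^+ 2))).
    rewrite mulrA ler_wpM2r// -natr1.
    have : 0 <= k%:R * (q - 1) * (q - 1) by rewrite !mulr_ge0.
    lra.
  apply: (@le_trans _ _ (q * u (N + k)%N ^+ 2)).
    by rewrite ler_pM2l//; lra.
  apply: ler_wpM2r; first exact: sqr_ge0.
  by rewrite expr2; nra.
have uN : 0 < u N ^+ 2 by rewrite exprn_even_gt0//= vy.
have d0 : 0 < (q - 1) * u N ^+ 2 by rewrite mulr_gt0// subr_gt0.
have [k] : exists k : nat, dot v v * C / ((q - 1) * u N ^+ 2) < k%:R.
  by exists (Num.truncn (dot v v * C / ((q - 1) * u N ^+ 2))).+1; exact: truncnS_gt.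
rewrite ltr_pdivrMr// => h.
have := dot_eigenvector_iter_le (N + k)%N; have := u2 k; lra.
Unshelve. all: by end_near.
Qed.

(** Makes the factor eventually positive, which freezes the sign of the component along v. *)
Lemma factor_cvg : c @ \oo --> (1 : R).
Proof.
rewrite -[X in _ --> X](_ : 1 - 2 * alpha + alpha * L / slim = 1).
  apply: cvgD; first exact: cvg_cst.
  apply: cvgM; first exact: cvg_cst.
  apply: cvgV; last exact: snorm_iter_cvg.
  by rewrite slim_eq gt_eqF// divr_gt0.
by rewrite slim_eq; field; rewrite gt_eqF.
Qed.

(** Write y_k = a_k p + e_k with p fixed and e_k tending to 0. The limit of |y_k|^2 determines that
    of |a_k|, and the sign of a_k is eventually constant, so a_k converges. *)
Lemma iterates_cvg_minimizer : exists2 l, ecvg y l &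
  forall z, objective M 1%:M l <= objective M 1%:M z.
Proof.
pose N := M - L%:M.
have Ns : N^T = N by rewrite /N linearB /= tr_scalar_mx pM.1.
(* D *m N is the projection onto the range of N along its kernel. *)
have [D ND] := sym_submx_square Ns.
(* From M y = s (2 y - g). Both terms tend to 0, since g does and s tends to L / 2. *)
have NE k : N *m y k = (- s k) *: g k + (2 * s k - L) *: y k.
  rewrite /N mulmxBl mul_scalar_mx /g /grad scaleNr -scalerN opprB scalerBr.
  rewrite !scalerA.
  rewrite -/(s k) divff ?gt_eqF ?snorm_iter_gt0// scale1r scalerBl.
  by rewrite (mulrC 2) addrA subrK.
have sL : 2 * s k - L @[k --> \oo] --> 2 * slim - L.
  apply: cvgB; last exact: cvg_cst.
  by apply: cvgM; [exact: cvg_cst|exact: snorm_iter_cvg].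
have Ny0 : ecvg (fun k => N *m y k) 0.
  apply: (@ecvg0_dot _ _ _ 2 (fun k => s k ^+ 2 * dot (g k) (g k) +
                                  (2 * s k - L) ^+ 2 * C)) => [k|].
    rewrite NE; apply: le_trans (dot_add_le _ _) _.
    rewrite ler_pM2l// !(dotZl, dotZr) !mulrA -!expr2 sqrrN lerD2l.
    by rewrite ler_wpM2l ?sqr_ge0// dot_iter_le.
  rewrite -[X in _ --> X](_ : slim ^+ 2 * 0 + (2 * slim - L) ^+ 2 * C = 0).
    apply: cvgD; apply: cvgM.
    - exact: (cvgM snorm_iter_cvg snorm_iter_cvg).
    - exact: dot_grad_cvg0.
    - exact: (cvgM sL sL).
    - exact: cvg_cst.
  by rewrite slim_eq mulr0 add0r mulrCA divff// mulr1 subrr expr0n mul0r.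
pose Q := 1%:M - D *m N.
have QM : Q *m M = L *: Q.
  have QN : Q *m N = 0 by rewrite /Q mulmxBl mul1mx -ND subrr.
  rewrite (_ : M = N + L%:M); last by rewrite /N subrK.
  by rewrite mulmxDr QN add0r mul_mx_scalar.
(* Since Q M = L Q, a step multiplies Q y by the same factor c as the component u. *)
have QS k : Q *m y k = (u k / u 0%N) *: (Q *m y 0%N).
  elim: k => [|k ih]; first by rewrite divff ?vy// scale1r.
  rewrite yS step_linearE mulmxDr -!scalemxAr mulmxA QM -scalemxAl.
  rewrite -/(s k) scalerA -scalerDl ih scalerA dot_eigenvector_step.
  by congr (_ *: _); rewrite /c; ring.
have yE k : y k = (u k / u 0%N) *: (Q *m y 0%N) + D *m (N *m y k).
  by rewrite -QS mulmxA -mulmxDl subrK mul1mx.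
have DN0 : ecvg (fun k => D *m (N *m y k)) 0.
  by rewrite -(mulmx0 _ D); exact: ecvg_mulmx.
pose p := Q *m y 0%N; pose a k := u k / u 0%N.
have ye0 : dot (y k) (D *m (N *m y k)) @[k --> \oo] --> (0 : R).
  apply: (@cvg0_sqr_le _ _ (fun k => dot (D *m (N *m y k)) (D *m (N *m y k))) C).
    move=> k; apply: le_trans (cauchy_schwarz _ _) _.
    by rewrite ler_wpM2r ?dot_ge0// dot_iter_le.
  by have := cvg_dot DN0 DN0; rewrite dot0r.
have ap : a k ^+ 2 * dot p p @[k --> \oo] --> L / 4.
  rewrite (_ : (fun k => _) = fun k => dot (y k) (y k) -
      2 * dot (y k) (D *m (N *m y k)) +
      dot (D *m (N *m y k)) (D *m (N *m y k))); last first.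
    apply/funext => k; set e := D *m (N *m y k).
    have -> : a k ^+ 2 * dot p p = dot (a k *: p) (a k *: p).
      by rewrite dotZl dotZr mulrA expr2.
    have -> : a k *: p = y k - e by rewrite [in RHS]yE addrK.
    by rewrite dotDl !dotDr dotNl !dotNr dotNl (dotC e (y k)); ring.
  have -> : L / 4 = slim / 2 - 2 * 0 + 0.
    by rewrite slim_eq; field.
  apply: cvgD; first apply: cvgB; first exact: dot_iter_cvg.
    by apply: cvgM => //; exact: cvg_cst.
  by have := cvg_dot DN0 DN0; rewrite dot0r.
have d0 : dot p p != 0.
  apply/eqP => d0; have /eqP : L / 4 = 0.
    move: ap; rewrite d0; under eq_fun do rewrite mulr0.
    by move/cvg_lim => <-//; rewrite lim_cst.
  by apply/negP; rewrite gt_eqF// divr_gt0.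
have a2 : a k ^+ 2 @[k --> \oo] --> L / 4 / dot p p.
  under eq_fun do rewrite -[_ ^+ 2](mulfK d0).
  by apply: cvgM ap _; exact: cvg_cst.
have an : `|a k| @[k --> \oo] --> Num.sqrt (L / 4 / dot p p).
  under eq_fun do rewrite -sqrtr_sqr.
  by apply: continuous_cvg a2; exact: sqrt_continuous.
have [K _ cK] : \forall k \near \oo, 0 < c k.
  exact: (cvgr_gt _ factor_cvg).
have aK k : a (K + k)%N = Num.sg (a K) * `|a (K + k)%N|.
  rewrite [LHS]numEsg; congr (_ * _).
  elim: k => [|k ih]; first by rewrite addn0.
  rewrite -ih addnS /a dot_eigenvector_step -mulrA sgrM gtr0_sg ?mul1r//.
  by apply: cK; exact: leq_addr.
have ab : a @ \oo --> Num.sg (a K) * Num.sqrt (L / 4 / dot p p).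
  apply: (@cvg_trans _ (Num.sg (a K) * `|a k| @[k --> \oo])).
    apply: near_eq_cvg; near=> k.
    have Kk : (K <= k)%N by near: k; exact: nbhs_infty_ge.
    by rewrite -(subnKC Kk) -aK.
  by apply: cvgM => //; exact: cvg_cst.
pose l := (Num.sg (a K) * Num.sqrt (L / 4 / dot p p)) *: p.
have yl : ecvg y l.
  have := ecvgD (ecvgZ ab (@ecvg_cst _ _ p)) DN0; rewrite addr0.
  by rewrite (_ : (fun k => _) = y)//; apply/funext => k; rewrite [RHS]yE.
exists l => // z.
have Fl : F @ \oo --> objective M 1%:M l.
  rewrite objective_scalarE.
  rewrite (_ : F = fun k => dot (y k) (y k) - snorm (y k)); last first.
    by apply/funext => k; rewrite /F objective_scalarE.
  apply: cvgB; first exact: cvg_dot.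
  apply: (@continuous_cvg _ _ _ _ _ (fun k => qform M (y k)) (@Num.sqrt R)).
    exact: sqrt_continuous.
  exact: cvg_qform.
(* F tends to -slim / 2 = -L / 4, which is the lower bound of [objective_ge]. *)
have -> : objective M 1%:M l = - (L / 4).
  rewrite -(cvg_lim _ Fl)//; have := slim_eq; rewrite /slim; lra.
exact: objective_ge.
Unshelve. all: by end_near.
Qed.

End gradient_iteration.

(** * Eliminating the nested square roots from the stepsize condition *)

Lemma finite_root (R : idomainType) (p : {poly R}) :
  p != 0 -> finite_set [set a | root p a].
Proof.
move=> p0; apply: contrapT => /(infinite_set_fset (size p))[B Bp].
apply/negP; rewrite -ltnNge; apply: max_poly_roots (fset_uniq B) => //.
by apply/allP => a aB; exact: (Bp a).
Qed.

Section sign_branches.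
Context {R : realType} {n : nat}.
Variables (M : 'M[R]_n) (L : R) (v : 'cV[R]_n).
Hypotheses (pM : sym_psd M) (L0 : 0 < L) (Mv : M *m v = L *: v).
Variable y0 : 'cV[R]_n.

(* Division-free iteration: for positive signs branch a s is (p *: y, p), where
   y is the iterate after size s steps and p > 0 a common denominator. The most
   recent sign is the head of s. *)
Fixpoint branch (a : R) (s : seq bool) : 'cV[R]_n * R :=
  if s is b :: s' then
    let Y := (branch a s').1 in
    let p := (branch a s').2 in
    let r := (-1) ^+ b * snorm M Y in
    (((1 - 2 * a) * r) *: Y + (a * p) *: (M *m Y), r * p)
  else (y0, 1).

Let q a s := qform M (branch a s).1.

(** Elements of a tower of k quadratic extensions of the polynomials in a. The coefficients [G0] and
    [G1] do not see the newest sign, so flipping it is conjugation. *)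
Fixpoint branch_algebraic k (G : R -> seq bool -> R) : Prop :=
  if k is k'.+1 then
    exists G0 G1, [/\ branch_algebraic k' G0, branch_algebraic k' G1 &
      forall a b s, size s = k' -> G a (b :: s) =
        G0 a s + (-1) ^+ b * snorm M (branch a s).1 * G1 a s]
  else exists p : {poly R}, forall a, G a [::] = p.[a].

Lemma eq_branch_algebraic k G H :
  (forall a s, size s = k -> G a s = H a s) ->
  branch_algebraic k G -> branch_algebraic k H.
Proof.
case: k => [|k] GH /=.
  by case=> p pE; exists p => a; rewrite -GH.
move=> [G0 [G1 [G0k G1k GE]]]; exists G0, G1; split => // a b s sk.
by rewrite -GH ?GE//= sk.
Qed.

Lemma branch_algebraic_poly k (p : {poly R}) :
  branch_algebraic k (fun a _ => p.[a]).
Proof.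
elim: k p => [|k ih] p /=; first by exists p.
exists (fun a _ => p.[a]), (fun a _ => (0 : {poly R}).[a]).
by split=> // a b s _; rewrite horner0 mulr0 addr0.
Qed.

Lemma branch_algebraic_cst k c : branch_algebraic k (fun _ _ => c).
Proof.
apply: eq_branch_algebraic (branch_algebraic_poly k c%:P) => a s _.
by rewrite hornerC.
Qed.

Lemma branch_algebraicD k G H : branch_algebraic k G -> branch_algebraic k H ->
  branch_algebraic k (fun a s => G a s + H a s).
Proof.
elim: k G H => [|k ih] G H /=.
  by move=> [p pE] [p' pE']; exists (p + p') => a; rewrite hornerD pE pE'.
move=> [G0 [G1 [G0k G1k GE]]] [H0 [H1 [H0k H1k HE]]].
exists (fun a s => G0 a s + H0 a s), (fun a s => G1 a s + H1 a s).
split; [exact: ih|exact: ih|move=> a b s sk].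
by rewrite GE// HE//; ring.
Qed.

Lemma branch_algebraic_sum k (I : Type) (r : seq I) G :
  (forall i, branch_algebraic k (G i)) ->
  branch_algebraic k (fun a s => \sum_(i <- r) G i a s).
Proof.
move=> Gk; elim: r => [|i r ih].
  apply: eq_branch_algebraic (branch_algebraic_cst k 0) => a s _.
  by rewrite big_nil.
apply: eq_branch_algebraic (branch_algebraicD (Gk i) ih) => a s _.
by rewrite big_cons.
Qed.

Lemma branch_root_sqr (b : bool) a s :
  ((-1) ^+ b * snorm M (branch a s).1) ^+ 2 = q a s.
Proof. by rewrite exprMn sqrr_sign mul1r snorm_sqr. Qed.

(** The product of G0 + r G1 and H0 + r H1 contains r^2 = q, so q itself must be algebraic at the
    lower levels. *)
Lemma branch_algebraicM k G H : (forall j, (j < k)%N -> branch_algebraic j q) ->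
  branch_algebraic k G -> branch_algebraic k H ->
  branch_algebraic k (fun a s => G a s * H a s).
Proof.
elim: k G H => [|k ih] G H qk /=.
  by move=> [p pE] [p' pE']; exists (p * p') => a; rewrite hornerM pE pE'.
move=> [G0 [G1 [G0k G1k GE]]] [H0 [H1 [H0k H1k HE]]].
have {}ih G' H' : branch_algebraic k G' -> branch_algebraic k H' ->
    branch_algebraic k (fun a s => G' a s * H' a s).
  by apply: ih => j jk; apply: qk; exact: ltnW.
exists (fun a s => G0 a s * H0 a s + q a s * (G1 a s * H1 a s)),
  (fun a s => G0 a s * H1 a s + G1 a s * H0 a s).
split=> [||a b s sk].
- apply: branch_algebraicD; first exact: ih.
  by apply: (ih q); [exact: qk|exact: ih].
- by apply: branch_algebraicD; exact: ih.
by rewrite GE// HE// -(branch_root_sqr b); ring.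
Qed.

(** A joint induction: products at level k need q below k, and q at level k is built from such
    products. This discharges the hypothesis of [branch_algebraicM]. *)
Lemma branch_algebraic_branch k :
  [/\ forall j, (j < k)%N -> branch_algebraic j q,
      forall i, branch_algebraic k (fun a s => (branch a s).1 i 0) &
      branch_algebraic k (fun a s => (branch a s).2)].
Proof.
elim: k => [|k [qk Yk pk]].
  by split=> // [i|]; [exists (y0 i 0)%:P|exists 1] => a; rewrite hornerE.
have MYk i : branch_algebraic k (fun a s => (M *m (branch a s).1) i 0).
  apply: (@eq_branch_algebraic _ (fun a s => \sum_j M i j * (branch a s).1 j 0)).
    by move=> a s _; rewrite mxE.
  apply: branch_algebraic_sum => j; apply: branch_algebraicM => //.
  exact: branch_algebraic_cst.
have qkk : branch_algebraic k q.
  apply: (@eq_branch_algebraic _ (fun a s =>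
      \sum_i (branch a s).1 i 0 * (M *m (branch a s).1) i 0)).
    by move=> a s _; rewrite /q qformE dotE.
  by apply: branch_algebraic_sum => i; exact: branch_algebraicM.
split=> [j|i|].
- by rewrite ltnS leq_eqVlt => /predU1P[->//|]; exact: qk.
- exists (fun a s => ('X : {poly R}).[a] * ((branch a s).2 * (M *m (branch a s).1) i 0)),
    (fun a s => (1 - 2 *: 'X : {poly R}).[a] * (branch a s).1 i 0); split.
  + apply: branch_algebraicM => //; first exact: branch_algebraic_poly.
    exact: branch_algebraicM.
  + by apply: branch_algebraicM => //; exact: branch_algebraic_poly.
  + by move=> a b s _; rewrite /= !mxE hornerX hornerD hornerN hornerZ hornerX -polyC1 hornerC; ring.
- exists (fun _ _ => 0), (fun a s => (branch a s).2); split=> //.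
    exact: branch_algebraic_cst.
  by move=> a b s _ /=; rewrite add0r.
Qed.

(* The norm (G0 + r G1) (G0 - r G1) = G0^2 - q G1^2 eliminates the last root. *)
Lemma branch_algebraic_elim k G : branch_algebraic k G ->
  exists p : {poly R}, forall a,
    root p a <-> exists2 s, size s = k & G a s = 0.
Proof.
elim: k G => [|k ih] G.
  move=> [p pE]; exists p => a; rewrite /root -pE; split.
    by move=> /eqP G0; exists [::].
  by move=> [s /size0nil -> ->].
move=> [G0 [G1 [G0k G1k GE]]].
have [qk _ _] := branch_algebraic_branch k.
have [qSk _ _] := branch_algebraic_branch k.+1.
have [|p pE] := ih (fun a s => G0 a s * G0 a s + (-1) * (q a s * (G1 a s * G1 a s))).
  apply: branch_algebraicD; first exact: branch_algebraicM.
  apply: branch_algebraicM; [by []|exact: branch_algebraic_cst|].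
  by apply: branch_algebraicM; [by []|exact: qSk|exact: branch_algebraicM].
have NE a s : size s = k ->
    G0 a s * G0 a s + (-1) * (q a s * (G1 a s * G1 a s)) =
    G a (false :: s) * G a (true :: s).
  by move=> sk; rewrite !GE// -(branch_root_sqr false) expr0 expr1; ring.
exists p => a; rewrite pE; split.
- move=> [s sk]; rewrite NE// => /eqP; rewrite mulf_eq0.
  by case/orP => /eqP G0'; [exists (false :: s)|exists (true :: s)];
    rewrite //= sk.
- move=> [[//|b s] [sk] Gbs]; exists s => //.
  by rewrite NE//; case: b Gbs => ->; rewrite ?mulr0 ?mul0r.
Qed.

(* At a = 0 the iteration only rescales y0, on every branch. *)
Lemma branch_zeros_finite k : dot v y0 != 0 ->
  exists2 p : {poly R}, p != 0 &
    forall a s, size s = k -> dot v (branch a s).1 = 0 -> root p a.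
Proof.
move=> vy0; have [qk Yk _] := branch_algebraic_branch k.
have [|p pE] := @branch_algebraic_elim k (fun a s => dot v (branch a s).1).
  apply: (@eq_branch_algebraic _ (fun a s => \sum_i v i 0 * (branch a s).1 i 0)).
    by move=> a s _; rewrite dotE.
  apply: branch_algebraic_sum => i; apply: branch_algebraicM => //.
  exact: branch_algebraic_cst.
exists p => [|a s sk vY]; last by apply/pE; exists s.
have B0 s : dot v (branch 0 s).1 != 0.
  elim: s => //= b s ih.
  rewrite mulr0 subr0 mul1r mul0r scale0r addr0 dotZr !mulf_neq0// ?signr_eq0//.
  by rewrite gt_eqF// snorm_gt0; exact: (qform_gt0 pM L0 Mv).
apply/eqP => p0; have /pE[s _ /eqP] : root p 0 by rewrite p0 root0.
by rewrite (negbTE (B0 s)).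
Qed.

(** By homogeneity of [snorm], the root r equals p times s_k, so clearing denominators only rescales
    the iterate. Nonvanishing of v.y_j before k keeps p positive. *)
Lemma branch_iterates a y k : y 0%N = y0 ->
  (forall j, y j.+1 = step M 1%:M a (y j)) ->
  (forall j, (j < k)%N -> dot v (y j) != 0) ->
  (branch a (nseq k false)).1 = (branch a (nseq k false)).2 *: y k /\
  0 < (branch a (nseq k false)).2.
Proof.
move=> y0E yS; elim: k => [|k ih] vy /=.
  by rewrite scale1r y0E.
have [|-> p0] := ih; first by move=> j jk; apply: vy; exact: ltnW.
set p := (branch _ _).2 in p0 *.
have s0 : 0 < snorm M (y k).
  by rewrite snorm_gt0; apply: (qform_gt0 pM L0 Mv); exact: vy.
have -> : snorm M (p *: y k) = p * snorm M (y k).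
  rewrite /snorm !qformE -scalemxAr dotZl dotZr mulrA -expr2.
  by rewrite sqrtrM ?sqr_ge0// sqrtr_sqr gtr0_norm.
rewrite expr0 mul1r; split; last by rewrite !mulr_gt0.
rewrite yS step_linearE scalerDr -scalemxAr !scalerA; congr (_ *: _ + _ *: _).
  by ring.
by field; rewrite gt_eqF.
Qed.

(** The least zero is taken because the branch is known to follow the iteration only up to there;
    later steps may divide by zero. *)
Lemma branch_first_zero a y : y 0%N = y0 ->
  (forall j, y j.+1 = step M 1%:M a (y j)) ->
  (exists j, dot v (y j) = 0) ->
  exists k, dot v (branch a (nseq k false)).1 = 0.
Proof.
move=> y0E yS vy.
have ex : exists j, dot v (y j) == 0 by case: vy => j /eqP; exists j.
case: (ex_minnP ex) => k /eqP yk kmin; exists k.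
have [|-> _] := @branch_iterates a y k y0E yS.
  by move=> j jk; apply/negP => /kmin; rewrite leqNgt jk.
by rewrite dotZr yk mulr0.
Qed.

Lemma branch_zeros_countable : dot v y0 != 0 ->
  countable [set a | exists k, dot v (branch a (nseq k false)).1 = 0].
Proof.
move=> vy0.
rewrite (_ : [set a | _] =
    \bigcup_k [set a | dot v (branch a (nseq k false)).1 = 0]); last first.
  by apply/seteqP; split=> a [k]; exists k.
apply: bigcup_countable => // k _; apply: finite_set_countable.
have [p p0 pE] := branch_zeros_finite k vy0.
apply: sub_finite_set (finite_root p0) => a /= va.
by apply: (pE _ (nseq k false)); rewrite ?size_nseq.
Qed.

End sign_branches.

(** * Null sets through Fubini, and hyperplanes *)

Lemma product_measure1_null d1 d2 (T1 : measurableType d1)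
    (T2 : measurableType d2) (R : realType)
    (m1 : {measure set T1 -> \bar R})
    (m2 : {sigma_finite_measure set T2 -> \bar R}) (A : set (T1 * T2)) :
  measurable A -> m1.-negligible [set x | m2 (xsection A x) != 0] ->
  (m1 \x m2)%E A = 0.
Proof.
move=> mA [H [mH H0 AH]].
have : ae_eq m1 setT (m2 \o xsection A) (cst 0%E).
  exists H; split => // x; apply: contraPP => Hx.
  by move=> /=; apply => _; apply: contrapT => /eqP; exact: contra_not (AH x) Hx.
rewrite /product_measure1 => /ge0_ae_eq_integral ->//.
- exact: integral0.
- exact: measurable_fun_xsection.
Qed.

Section null_sets.
Context {R : realType}.
Local Notation Rm := (measurableTypeR R).

Lemma measurable_affine n (w : 'I_n -> R) :
  measurable_fun setT
    (fun t : n.-tuple Rm => \sum_(i < n) w i * (tnth t i : R)).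
Proof.
apply: measurable_sum => i; apply: measurable_funM => //.
exact: (measurable_tnth i).
Qed.

Lemma measurable_hyperplane n (w : 'I_n -> R) c :
  measurable [set t : n.-tuple Rm | \sum_(i < n) w i * (tnth t i : R) = c].
Proof.
rewrite -[X in measurable X]setTI.
exact: (measurable_affine w measurableT (measurable_set1 c)).
Qed.

(** Slice along the first coordinate. If a later coefficient is nonzero, each slice is a hyperplane
    of lower dimension; otherwise all slices are empty except at c / w_0. *)
Lemma hyperplane_null n (w : 'I_n -> R) c : (exists i, w i != 0) ->
  lebesgue_tuple n
    [set t : n.-tuple Rm | \sum_(i < n) w i * (tnth t i : R) = c] = 0%E.
Proof.
elim: n w c => [w c [[]//]|n ih w c [i wi]].
have tnth_tcons (p : Rm * n.-tuple Rm) (j : 'I_n) :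
    tnth (tcons p) (lift ord0 j) = tnth p.2 j by rewrite tnthS.
have mS := measurable_hyperplane w c.
have mS' := measurable_tcons measurableT mS; rewrite setTI in mS'.
apply: product_measure1_null => //.
have sectionE a : xsection (tcons @^-1`
      [set t : n.+1.-tuple Rm | \sum_(i < n.+1) w i * (tnth t i : R) = c]) a =
    [set t : n.-tuple Rm | \sum_(i < n) w (lift ord0 i) * (tnth t i : R) =
                           c - w ord0 * a].
  apply/seteqP; split => t.
    move=> /xsectionP /=; rewrite big_ord_recl => <-.
    rewrite [tnth _ ord0]/= addrAC subrr add0r.
    by apply: eq_bigr => j _; rewrite tnth_tcons.
  move=> h; apply/xsectionP => /=; rewrite big_ord_recl.
  by under eq_bigr do rewrite tnth_tcons; rewrite h addrC subrK.
have [wj|w0] := pselect (exists j, w (lift ord0 j) != 0).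
  exists set0; split => // a /=; rewrite sectionE ih ?eqxx//.
have {}w0 j : w (lift ord0 j) = 0.
  by apply: contrapT => /eqP wj; apply: w0; exists j.
have wi0 : w ord0 != 0 by case: (unliftP ord0 i) wi => [j ->|->//]; rewrite w0 eqxx.
exists [set c / w ord0]; split => //.
  exact: lebesgue_measure_set1.
move=> a /=; rewrite sectionE; apply: contra_neqP => ac.
rewrite (_ : [set t | _] = set0) ?measure0// -subset0 => t /=.
rewrite big1 => [/esym/eqP|j _]; last by rewrite w0 mul0r.
by rewrite subr_eq0 => /eqP cw; apply: ac; rewrite cw mulrAC divff// mul1r.
Qed.

End null_sets.

(** * The exceptional pairs form a measurable null set *)

Section exceptional_set.
Context {R : realType} {n : nat}.
Variables (M P : 'M[R]_n) (L : R) (v : 'cV[R]_n).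
Hypotheses (pM : sym_psd M) (L0 : 0 < L) (Mv : M *m v = L *: v) (v0 : v != 0).
Hypothesis uP : P \in unitmx.
Local Notation Rm := (measurableTypeR R).

Let br k (p : n.-tuple Rm * Rm) :=
  branch M (P *m col_of_tuple p.1) p.2 (nseq k false).

(** Stated with the division-free branch rather than the iterates, so that the finiteness of its
    zeros in the stepsize applies at each k. *)
Definition exceptional_set : set (n.-tuple Rm * Rm) :=
  [set p | exists k, dot v (br k p).1 = 0].

Lemma measurable_branch k :
  (forall i, measurable_fun setT (fun p => (br k p).1 i 0)) /\
  measurable_fun setT (fun p => (br k p).2).
Proof.
elim: k => [|k [Yk pk]].
  split=> [i|]; last exact: measurable_cst.
  rewrite [X in measurable_fun _ X](_ : _ =
      fun p => \sum_j P i j * (tnth p.1 j : R)).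
    apply: measurable_sum => j; apply: measurable_funM => //.
    by apply: (measurableT_comp (measurable_tnth j)); exact: measurable_fst.
  by apply/funext => p; rewrite /br /= mxE; apply: eq_bigr => j _; rewrite mxE.
have MYk i : measurable_fun setT (fun p => (M *m (br k p).1) i 0).
  under eq_fun do rewrite mxE.
  by apply: measurable_sum => j; exact: measurable_funM.
have nk : measurable_fun setT (fun p => snorm M (br k p).1).
  apply: (@measurableT_comp _ _ _ _ _ _ (@Num.sqrt R) _
      (fun p => qform M (br k p).1)).
    by apply: continuous_measurable_fun; exact: sqrt_continuous.
  under eq_fun do rewrite qformE dotE.
  by apply: measurable_sum => j; exact: measurable_funM.
have ma : measurable_fun setT (fun p : n.-tuple Rm * Rm => (p.2 : R)).
  exact: measurable_snd.
split=> [i|].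
  rewrite [X in measurable_fun _ X](_ : _ = fun p : n.-tuple Rm * Rm =>
      ((1 - 2 * p.2) * snorm M (br k p).1) * (br k p).1 i 0 +
      (p.2 * (br k p).2) * (M *m (br k p).1) i 0).
    apply: measurable_funD; apply: measurable_funM => //; apply: measurable_funM => //.
    by apply: measurable_funB => //; exact: measurable_funM.
  by apply/funext => p; rewrite /br /= expr0 mul1r [LHS]mxE 2![in LHS]mxE.
rewrite [X in measurable_fun _ X](_ : _ = fun p : n.-tuple Rm * Rm =>
      snorm M (br k p).1 * (br k p).2).
  exact: measurable_funM.
by apply/funext => p; rewrite /br /= expr0 mul1r.
Qed.

Lemma measurable_exceptional_set : measurable exceptional_set.
Proof.
rewrite (_ : exceptional_set = \bigcup_k [set p | dot v (br k p).1 = 0]); last first.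
  by apply/seteqP; split=> p [k]; exists k.
apply: bigcupT_measurable => k.
have mk : measurable_fun setT (fun p => dot v (br k p).1).
  under eq_fun do rewrite dotE.
  apply: measurable_sum => i; apply: measurable_funM => //.
  exact: (measurable_branch k).1.
rewrite -[X in measurable X]setTI.
exact: (mk measurableT _ (measurable_set1 0)).
Qed.

Lemma exceptional_set_null :
  (lebesgue_tuple n \x @lebesgue_measure R)%E exceptional_set = 0%E.
Proof.
apply: product_measure1_null; first exact: measurable_exceptional_set.
(* Coefficients of the linear form t -> v.(P t), nonzero because P is invertible. *)
pose w (i : 'I_n) : R := (P^T *m v) i 0.
have w0 : exists i, w i != 0.
  apply: contrapT => h; have Pv : P^T *m v = 0.
    apply/colP => i; rewrite [RHS]mxE; apply: contrapT => /eqP wi.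
    by apply: h; exists i.
  have uPT : P^T \in unitmx by rewrite unitmx_tr.
  by case/negP: v0; apply/eqP; rewrite -(mulKmx uPT v) Pv mulmx0.
exists [set t : n.-tuple Rm | \sum_(i < n) w i * (tnth t i : R) = 0]; split.
- exact: measurable_hyperplane.
- exact: hyperplane_null.
move=> t /=; apply: contra_neqP => wt.
(* Off that hyperplane only countably many stepsizes are exceptional. *)
apply: countable_lebesgue_measure0.
rewrite (_ : xsection _ t = [set a |
    exists k, dot v (branch M (P *m col_of_tuple t) a (nseq k false)).1 = 0]).
  apply: branch_zeros_countable pM L0 Mv _ _.
  rewrite dotC dot_mulmxl dotC dotE; apply/eqP => h; apply: wt => /=.
  by apply: etrans h; apply: eq_bigr => i _; congr (_ * _); rewrite [RHS]mxE.
by apply/seteqP; split=> a; [move/xsectionP|move=> h; apply/xsectionP].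
Qed.

End exceptional_set.

(** * Invariance under the coordinates y = P x *)

Section change_of_variables.
Context {R : realType} {n : nat}.
Variable P : 'M[R]_n.
Hypothesis uP : P \in unitmx.
Implicit Types (A B : 'M[R]_n) (x z : 'cV[R]_n).

Lemma transform_mulmx A x : transform P A *m (P *m x) = (invmx P)^T *m (A *m x).
Proof. by rewrite /transform -!mulmxA mulKmx. Qed.

Lemma qform_transform A x : qform (transform P A) (P *m x) = qform A x.
Proof. by rewrite !qformE transform_mulmx -dot_mulmxl mulKmx. Qed.

Lemma objective_transform A B x :
  objective (transform P A) (transform P B) (P *m x) = objective A B x.
Proof. by rewrite /objective !qform_transform. Qed.

Lemma transform_sym_psd A : sym_psd A -> sym_psd (transform P A).
Proof.
move=> [As Ap]; split=> [|z].
  by rewrite /transform !trmx_mul trmxK As mulmxA.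
by rewrite -[z](mulKVmx uP) qform_transform.
Qed.

Lemma transform_neq0 A : A != 0 -> transform P A != 0.
Proof.
apply: contra_neq => A0.
have <- : P^T *m transform P A *m P = A; last by rewrite A0 mulmx0 mul0mx.
by rewrite /transform !mulmxA -trmx_mul mulVmx// trmx1 mul1mx mulmxKV.
Qed.

End change_of_variables.

Theorem corollary3p11 (R : realType) (n : nat) (A B P : 'M[R]_n)
    (psdA : sym_psd A) (A_neq0 : A != 0) (pdB : sym_pd B)
    (P_unit : P \in unitmx) (PB : transform P B = 1%:M) :
  \forall p \ae (lebesgue_tuple n \x @lebesgue_measure R)%E,
    0 < (p.2 : R) < 1 ->
    converges_to_global_minimizer A B P p.2 (col_of_tuple p.1).
Proof.
have pM := transform_sym_psd P_unit psdA.
set M := transform P A in pM.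
have [L [v [L0 v0 Mv ML]]] := top_eigenvector pM (transform_neq0 P_unit A_neq0).
exists (exceptional_set M P v); split.
- exact: measurable_exceptional_set.
- exact: exceptional_set_null pM L0 Mv v0 P_unit.
move=> [t a] /=; apply: contra_notP => not_exceptional a01.
set x := iterates A B P a (col_of_tuple t).
pose y k := P *m x k.
have yS k : y k.+1 = step M 1%:M a (y k) by rewrite /y /x /= PB mulKVmx.
have vy k : dot v (y k) != 0.
  apply/eqP => vyk; apply: not_exceptional.
  by apply: (branch_first_zero pM L0 Mv _ yS) => //; exists k.
split=> [k|].
  (* A x_k = 0 would give M y_k = 0, hence L (v.y_k) = v.My_k = 0. *)
  apply: contra_neq (vy k) => Ax0.
  have := dot_eigenvector pM Mv (y k).
  rewrite /M transform_mulmx// Ax0 mulmx0 dot0r => /esym/eqP.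
  by rewrite mulf_eq0 gt_eqF//= => /eqP.
have [l yl lmin] := iterates_cvg_minimizer pM L0 Mv ML a01 yS vy.
exists (invmx P *m l).
  apply: ecvg_cvg; rewrite (_ : iterates _ _ _ _ _ = fun k => invmx P *m y k).
    exact: ecvg_mulmx.
  by apply/funext => k; rewrite /y mulKmx.
move=> z; rewrite -[leLHS](objective_transform P_unit).
rewrite -[leRHS](objective_transform P_unit) PB mulKVmx//.
Qed.
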